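(* Consider an RBM with observed variables $X\in\{-1,1\}^n$ as in the context. Fix $\delta>0$, $\epsilon>0$, $\zeta>0$. Suppose that for every observed variable $u$ we are given a set $n(u)$ which is a subset of the MRF neighborhood of $u$ and contains every $i$ for which there is $T\subseteq[n]$ with $u,i\in T$ and $|\hat f(T)|\ge\zeta$. Suppose that we are given $M$ i.i.d. samples of $X$ from the RBM and run the regression procedure of the context at each $u$. There is an absolute constant $C>0$ such that if \[M\ge C\,\gamma^2\ln(8\cdot n\cdot 2^D/\delta)/\epsilon^2\quad\text{and}\quad\zeta\le\frac{\sqrt\epsilon}{\psi\sqrt{1+e^{2\gamma}}},\] then with probability at least $1-\delta$, for all observed variables $u$, \[\mathbb{E}\big[(\mathbb{P}(X_u=1|X_{[n]\setminus\{u\}})-\sigma(\hat w_u\cdot z_u))^2\big]\le\epsilon,\] where the expectation is over $X$ drawn from the marginal of the RBM (with $\hat w_u$ fixed) and $z_u$ is the feature vector of $X$ at $u$.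
   Context: RBM: $\mathbb{P}(X=x,Y=y)\propto\exp(x^TJy+h^Tx+g^Ty)$ over observed $X\in\{-1,1\}^n$ and latent $Y\in\{-1,1\}^m$. The marginal of $X$ is $\propto\exp(f(x))$, $f(x)=\sum_j\rho(J_j\cdot x+g_j)+h^Tx$, $\rho(t)=\log(e^t+e^{-t})$, $J_j$ the $j$-th column of $J$; $f=\sum_{T\subseteq[n]}\hat f(T)\chi_T$, $\chi_T(x)=\prod_{i\in T}x_i$. MRF neighborhood of $u$: all $i\ne u$ with $\hat f(T)\ne0$ for some $T\ni u,i$. $D$: max size of an MRF neighborhood; $\gamma=\max_u\sum_{T\ni u}|\hat f(T)|$; $\psi:=\max_{u\in[n]}|\{T\subseteq[n]:u\in T,\ \hat f(T)\ne0\}|$. $\sigma(t)=1/(1+e^{-t})$. Regression at $u$: feature vector $z_u=(\chi_T(X))_{T\subseteq n(u)}\in\{-1,1\}^{2^{|n(u)|}}$, label $y=X_u$; from samples $(z^{(k)},y^{(k)})_{k=1}^M$, $\hat w_u\in\arg\min\{\frac1M\sum_{k=1}^M\ln(1+e^{-y^{(k)}(w\cdot z^{(k)})}):w\in\mathbb{R}^{2^{|n(u)|}},\ \|w\|_1\le2\gamma\}$. *)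

(* Defs.v *)
From HB Require Import structures.
From mathcomp Require Import all_boot all_order all_algebra.
From mathcomp Require Import all_classical all_reals all_analysis.
Set Implicit Arguments. Unset Strict Implicit. Unset Printing Implicit Defensive.
Import Order.TTheory GRing.Theory Num.Theory.
Local Open Scope ring_scope.

(* Spin vectors: a configuration in {-1,1}^n is a boolean finite function,
   true |-> 1, false |-> -1. *)
Notation cube n := {ffun 'I_n -> bool}.

Definition spin {R : pzRingType} (b : bool) : R := if b then 1 else -1.

Section RBM.
Variables (R : realType) (n m : nat).
Variables (J : 'I_n -> 'I_m -> R) (h : 'I_n -> R) (g : 'I_m -> R).

Definition rbm_weight (x : cube n) (y : cube m) : R :=
  expR (\sum_i \sum_j spin (x i) * J i j * spin (y j)
        + \sum_i h i * spin (x i) + \sum_j g j * spin (y j)).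

Definition rbm_Z : R := \sum_(x : cube n) \sum_(y : cube m) rbm_weight x y.

Definition rbm_marg (x : cube n) : R := (\sum_(y : cube m) rbm_weight x y) / rbm_Z.

Definition rho (t : R) : R := ln (expR t + expR (- t)).

Definition chi (T : {set 'I_n}) (x : cube n) : R := \prod_(i in T) spin (x i).

Definition rbm_f (x : cube n) : R :=
  \sum_j rho (\sum_i J i j * spin (x i) + g j) + \sum_i h i * spin (x i).

Definition fhat (T : {set 'I_n}) : R :=
  (2 ^+ n)^-1 * \sum_(x : cube n) rbm_f x * chi T x.

Definition mrf_nbhd (u : 'I_n) : {set 'I_n} :=
  [set i | (i != u) &&
     [exists T : {set 'I_n}, [&& u \in T, i \in T & fhat T != 0]]].

Definition rbm_D : nat := \max_(u < n) #|mrf_nbhd u|.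

Definition rbm_gamma : R :=
  (\big[Num.max/0]_(u < n) (\sum_(T : {set 'I_n} | u \in T) `|fhat T|))%R.

Definition rbm_psi : nat :=
  \max_(u < n) #|[set T : {set 'I_n} | (u \in T) && (fhat T != 0%R)]|.

Definition setx (x : cube n) (u : 'I_n) (b : bool) : cube n :=
  [ffun i => if i == u then b else x i].

Definition condp (u : 'I_n) (x : cube n) : R :=
  rbm_marg (setx x u true) / (rbm_marg (setx x u true) + rbm_marg (setx x u false)).

(* weight vectors indexed by the subsets T of n(u); entries at other T are ignored *)
Definition dotz (nu : {set 'I_n}) (w : {set 'I_n} -> R) (x : cube n) : R :=
  \sum_(T : {set 'I_n} | T \subset nu) w T * chi T x.

Definition l1w (nu : {set 'I_n}) (w : {set 'I_n} -> R) : R :=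
  \sum_(T : {set 'I_n} | T \subset nu) `|w T|.

Definition emp_loss (M : nat) (nu : {set 'I_n}) (u : 'I_n)
    (s : {ffun 'I_M -> cube n}) (w : {set 'I_n} -> R) : R :=
  M%:R^-1 * \sum_(k < M) ln (1 + expR (- (spin (s k u) * dotz nu w (s k)))).

Definition is_erm (M : nat) (nu : {set 'I_n}) (u : 'I_n) (rad : R)
    (s : {ffun 'I_M -> cube n}) (w : {set 'I_n} -> R) : Prop :=
  l1w nu w <= rad /\
  forall w' : {set 'I_n} -> R, l1w nu w' <= rad -> emp_loss nu u s w <= emp_loss nu u s w'.

Definition sigmoid (t : R) : R := (1 + expR (- t))^-1.

Definition pred_err (nu : {set 'I_n}) (u : 'I_n) (w : {set 'I_n} -> R) : R :=
  \sum_(x : cube n) rbm_marg x * (condp u x - sigmoid (dotz nu w x)) ^+ 2.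

Definition sample_prob (M : nat) (E : {ffun 'I_M -> cube n} -> Prop) : R :=
  \sum_(s : {ffun 'I_M -> cube n} | `[< E s >]) \prod_(k < M) rbm_marg (s k).

End RBM.

(* Main.v *)
(** The conditional law of [X_u] is logistic with the coefficients [2 * fhat T],
    [T] containing [u], so the excess logistic risk of a weight vector is the
    mean of a Bregman divergence of [softplus], which dominates twice the squared
    prediction error.  Dropping the coefficients outside [n(u)] moves the log-odds
    by at most [2 * zeta * psi] and costs at most [eps / 2] of risk.

    The deviation of the empirical excess risk is controlled through its
    exponential moment.  The sample space being finite, it is enough to take the
    maximum over one bad weight vector per bad sample.  Coordinate by coordinate,
    symmetrization and the Ledoux-Talagrand contraction replace the loss by the
    linear form; on an l1 ball this is governed by the [2 * 2 ^ #|n(u)|] vertices,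
    each with a sub-Gaussian moment, and Markov's inequality followed by a union
    bound over [u] concludes with [C = 256]. *)

Require Import Defs.
From HB Require Import structures.
From mathcomp Require Import all_boot all_order all_algebra.
From mathcomp Require Import all_classical all_reals all_analysis.
From mathcomp Require Import ring lra.
Set Implicit Arguments. Unset Strict Implicit. Unset Printing Implicit Defensive.
Import Order.TTheory GRing.Theory Num.Theory.
Import numFieldNormedType.Exports.
Local Open Scope ring_scope.

(** * Calculus of the logistic function and Bregman bounds for [softplus] *)

Section Logistic.
Variable R : realType.
Implicit Types a b t x : R.

(** [f] is nonincreasing to the left of [a] and nondecreasing to its right, so [a] is a global
    minimum; both Bregman inequalities below are proved this way. *)
Lemma le_of_derive_sign (f df : R -> R) a b :
  (forall x, is_derive x 1 f (df x)) ->
  (forall x, 0 <= df x * (x - a)) -> f a <= f b.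
Proof.
move=> fdf dfa.
have cf c d : {within `[c, d], continuous f}%classic.
  apply: continuous_subspaceT => x.
  apply/differentiable_continuous/derivable1_diffP.
  by have [] := fdf x.
have [ab|ba|->//] := ltgtP a b.
- have [c] := MVT ab (fun x _ => fdf x) (cf a b).
  rewrite in_itv/= => /andP[ac cb] fab.
  have := dfa c; rewrite pmulr_lge0 ?subr_gt0// => df0.
  by rewrite -subr_ge0 fab mulr_ge0// subr_ge0 ltW.
- have [c] := MVT ba (fun x _ => fdf x) (cf b a).
  rewrite in_itv/= => /andP[bc ca] fab.
  have := dfa c; rewrite nmulr_lge0 ?subr_lt0// => df0.
  by rewrite -subr_le0 fab mulr_le0_ge0// subr_ge0 ltW.
Qed.

(** The log-partition function of a Bernoulli variable: its derivative is [sigmoid], and the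
    logistic loss at margin [t] is [softplus (- t)]. *)
Definition softplus t : R := ln (1 + expR t).

Lemma sigmoidE t : sigmoid t = expR t / (1 + expR t).
Proof.
rewrite /sigmoid expRN; have := expR_gt0 t => t0.
by field; rewrite ?lt0r_neq0 ?addr_gt0.
Qed.

Lemma is_derive_softplus t : is_derive t 1 softplus (sigmoid t).
Proof.
have t0 : 0 < 1 + expR t by rewrite addr_gt0 ?expR_gt0.
have dl := is_derive1_ln t0.
have de : is_derive t 1 (fun x : R => 1 + expR x) (expR t).
  by apply: is_derive_eq; ring.
have := @is_derive1_comp _ _ (fun x : R => 1 + expR x) _ _ _ dl de.
by rewrite sigmoidE mulrC.
Qed.

Lemma is_derive_sigmoid t :
  is_derive t 1 (@sigmoid R) (sigmoid t * (1 - sigmoid t)).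
Proof.
have t0 : 0 < 1 + expR (- t) by rewrite addr_gt0 ?expR_gt0.
have de : is_derive t 1 (fun x : R => 1 + expR (- x)) (- expR (- t)).
  by apply: is_derive_eq; ring.
have := @is_deriveV _ (fun x : R => 1 + expR (- x)) _ _ _ (lt0r_neq0 t0) de.
move=> H; apply: is_derive_eq.
rewrite /sigmoid /GRing.scale/=; field.
by rewrite lt0r_neq0.
Qed.

Lemma sigmoid_gt0 t : 0 < sigmoid t.
Proof. by rewrite invr_gt0 addr_gt0 ?expR_gt0. Qed.

Lemma sigmoid_lt1 t : sigmoid t < 1.
Proof. by rewrite invf_lt1 ?addr_gt0 ?expR_gt0// ltrDl expR_gt0. Qed.

(** The derivative of [sigmoid] lies between 0 and 1/4; multiplying by [b - a] covers both orders of
    [a] and [b]. *)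
Lemma sigmoid_lip_mono a b :
  0 <= (sigmoid b - sigmoid a) * (b - a) <= (b - a) ^+ 2 / 4.
Proof.
have main x y : x <= y -> sigmoid x <= sigmoid y /\ 4 * (sigmoid y - sigmoid x) <= y - x.
  move=> xy.
  have cs : {within `[x, y], continuous (@sigmoid R)}%classic.
    apply: continuous_subspaceT => z.
    apply/differentiable_continuous/derivable1_diffP.
    by have [] := is_derive_sigmoid z.
  have [c _ fab] := MVT_segment xy (fun z _ => is_derive_sigmoid z) cs.
  have c0 := sigmoid_gt0 c; have c1 := sigmoid_lt1 c.
  have q0 : 0 <= sigmoid c * (1 - sigmoid c) by rewrite mulr_ge0; lra.
  have q1 : sigmoid c * (1 - sigmoid c) <= 1 / 4.
    by have := sqr_ge0 (1 - 2 * sigmoid c); nra.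
  move: fab q0 q1; set q := (sigmoid c * _) => fab q0 q1.
  have xy0 : 0 <= y - x by rewrite subr_ge0.
  split; first by rewrite -subr_ge0 fab mulr_ge0.
  by rewrite fab; nra.
by have [/[dup]? /main[]|/ltW/[dup]? /main[]] := leP a b; nra.
Qed.

(** [sigmoid] is 1/4-Lipschitz, so the difference of the two sides has a derivative with the sign of
    [x - a]. *)
Lemma softplus_bregman_le a b :
  softplus b - softplus a - sigmoid a * (b - a) <= (b - a) ^+ 2 / 4.
Proof.
pose f x := (x - a) ^+ 2 / 4 - (softplus x - softplus a - sigmoid a * (x - a)).
pose df x := (x - a) / 2 - (sigmoid x - sigmoid a).
have fa0 : f a = 0 by rewrite /f; ring.
suff : f a <= f b by rewrite fa0 subr_ge0.
apply: (@le_of_derive_sign _ df) => x; last first.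
  have /andP[] := sigmoid_lip_mono a x; rewrite /df; nra.
have := is_derive_softplus x => ?.
apply: is_derive_eq.
by rewrite /df /GRing.scale/=; field.
Qed.

(** Pinsker's inequality for Bernoulli laws. The derivative of the gap is [sigmoid x - sigmoid a]
    times one minus four times the derivative of [sigmoid], and that factor is the square of
    [1 - 2 * sigmoid x]. *)
Lemma softplus_bregman_ge a b :
  2 * (sigmoid b - sigmoid a) ^+ 2 <=
  softplus b - softplus a - sigmoid a * (b - a).
Proof.
pose f x := softplus x - softplus a - sigmoid a * (x - a)
  - 2 * (sigmoid x - sigmoid a) ^+ 2.
pose df x := (sigmoid x - sigmoid a) * (1 - 2 * sigmoid x) ^+ 2.
have fa0 : f a = 0 by rewrite /f; ring.
suff : f a <= f b by rewrite fa0 subr_ge0.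
apply: (@le_of_derive_sign _ df) => x; last first.
  rewrite /df mulrAC mulr_ge0 ?sqr_ge0//.
  by have /andP[] := sigmoid_lip_mono a x.
have := is_derive_softplus x => ?.
have := is_derive_sigmoid x => ?.
apply: is_derive_eq.
by rewrite /df /GRing.scale/=; ring.
Qed.

Lemma softplusN t : softplus (- t) = softplus t - t.
Proof.
rewrite /softplus -{3}(expRK t) -ln_div ?posrE ?addr_gt0 ?expR_gt0//.
by congr ln; rewrite expRN; field; rewrite lt0r_neq0 ?expR_gt0.
Qed.

(** For [b <= a], exponentiating leaves [1 + expR a <= expR (a - b) * (1 + expR b)]. *)
Lemma softplus_lip a b : `|softplus a - softplus b| <= `|a - b|.
Proof.
wlog ab : a b / b <= a.
  move=> H; have [/H//|/ltW/H] := leP b a.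
  by rewrite distrC (distrC b).
rewrite !ger0_norm ?subr_ge0//; last first.
  by rewrite ler_ln ?posrE ?addr_gt0 ?expR_gt0// lerD2l ler_expR.
rewrite lerBlDr -(expRK (a - b)) -lnM ?posrE ?addr_gt0 ?expR_gt0//.
rewrite ler_ln ?posrE ?mulr_gt0 ?addr_gt0 ?expR_gt0//.
rewrite mulrDr mulr1 -expRD subrK lerD2r.
by rewrite -expR0 ler_expR subr_ge0.
Qed.

(* [ln (cosh x)] is the Bregman gap of [softplus] between [0] and [2 * x]. *)
Lemma cosh_le_expR_sqr x : expR x + expR (- x) <= 2 * expR (x ^+ 2).
Proof.
have := softplus_bregman_le 0 (2 * x).
rewrite subr0 /softplus /sigmoid oppr0 expR0.
have -> : (2 * x) ^+ 2 / 4 = x ^+ 2 by field.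
have -> : (1 + 1)^-1 * (2 * x) = x by field.
rewrite -(ler_expR (_ - _ - _)) !expRB !lnK ?posrE ?addr_gt0 ?expR_gt0//.
have -> : 2 * x = x + x by ring.
rewrite expRD expRN => H.
suff -> : expR x + (expR x)^-1 = 2 * ((1 + expR x * expR x) / (1 + 1) / expR x).
  by rewrite ler_pM2l.
by field; rewrite lt0r_neq0 ?expR_gt0.
Qed.

End Logistic.

(** * Convexity inequalities for the exponential *)

Section ExponentialMoments.
Variable R : realType.

(** Each [expR (v x)] lies above the tangent at the mean [e], and the slope terms average to
    zero. *)
Lemma expR_jensen (X : finType) (mu v : X -> R) :
  (forall x, 0 <= mu x) -> \sum_x mu x = 1 ->
  expR (\sum_x mu x * v x) <= \sum_x mu x * expR (v x).
Proof.
move=> mu0 mu1; set e := \sum_x mu x * v x.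
have -> : expR e = \sum_x mu x * (expR e * (1 + (v x - e))).
  transitivity (expR e * (\sum_x mu x + (\sum_x mu x * v x - (\sum_x mu x) * e))).
    by rewrite mu1 -/e; ring.
  rewrite mulr_suml -sumrB -big_split mulr_sumr; apply: eq_bigr => x _ /=; ring.
apply: ler_sum => x _; rewrite ler_wpM2l// -[in leRHS](subrKC e (v x)) expRD.
by rewrite ler_wpM2l ?expR_ge0// expR_ge1Dx.
Qed.

Lemma expR_midpoint (a b : R) : 2 * expR ((a + b) / 2) <= expR a + expR b.
Proof.
have -> : a = a / 2 + a / 2 by field.
have -> : b = b / 2 + b / 2 by field.
have -> : (a / 2 + a / 2 + (b / 2 + b / 2)) / 2 = a / 2 + b / 2 by field.
rewrite !expRD; have := sqr_ge0 (expR (a / 2) - expR (b / 2)); nra.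
Qed.

(** Written as [expR b * (expR l - 1)], the increment is monotone in each factor. *)
Lemma ler_expRB (a b l k : R) : b <= a -> 0 <= l -> l <= k ->
  expR (b + l) - expR b <= expR (a + k) - expR a.
Proof.
move=> ba l0 lk.
have ea : expR b <= expR a by rewrite ler_expR.
have el : 1 <= expR l by rewrite -expR0 ler_expR.
have ek : expR l <= expR k by rewrite ler_expR.
have b0 := expR_gt0 b.
rewrite !expRD; nra.
Qed.

(* The case analysis of Ledoux and Talagrand; the bounds U and V stand for the
   two suprema of the uncontracted family. *)
Lemma expR_contraction2 (a b t s p q U V : R) :
  `|p| <= `|t| -> `|q| <= `|s| -> `|p - q| <= `|t - s| ->
  expR (a + t) <= U -> expR (b + s) <= U ->
  expR (a - t) <= V -> expR (b - s) <= V ->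
  expR (a + p) + expR (b - q) <= U + V.
Proof.
have cosh_mono_nneg (c x y : R) : 0 <= x -> x <= y ->
    expR (c + x) + expR (c - x) <= expR (c + y) + expR (c - y).
  move=> x0 xy; have : c - y <= c + x by lra.
  move/(@ler_expRB _ _ (y - x) (y - x)).
  have -> : c - y + (y - x) = c - x by ring.
  have -> : c + x + (y - x) = c + y by ring.
  by rewrite subr_ge0 => /(_ xy (lexx _)); lra.
have cosh_mono (c x y : R) : `|x| <= `|y| ->
    expR (c + x) + expR (c - x) <= expR (c + y) + expR (c - y).
  have norm (z : R) : expR (c + z) + expR (c - z) = expR (c + `|z|) + expR (c - `|z|).
    by case: (ger0P z) => // _; rewrite opprK addrC.
  by rewrite (norm x) (norm y); apply: cosh_mono_nneg.
move=> pt qs pq aU bU aV bV.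
(* If one index dominates at both signs, the sum is a hyperbolic cosine at that index alone, which
   is monotone in the modulus. *)
have [abp|abp] := ltP (a + p) (b + q).
  have : expR (a + p) <= expR (b + q) by rewrite ler_expR ltW.
  by have := cosh_mono b _ _ qs; lra.
have [abq|abq] := ltP (b - q) (a - p).
  have : expR (b - q) <= expR (a - p) by rewrite ler_expR ltW.
  by have := cosh_mono a _ _ pt; lra.
(* In the remaining regime [b + q <= a + p] and [a - p <= b - q]. Whichever of [t'], [s'] is larger
   decides which of the two terms is raised and which lowered; [ler_expRB] compares the two
   increments. *)
have nonneg t' s' U' V' : 0 <= t' -> 0 <= s' -> `|p| <= t' -> `|q| <= s' ->
    `|p - q| <= `|t' - s'| -> expR (a + t') <= U' -> expR (b + s') <= U' ->
    expR (a - t') <= V' -> expR (b - s') <= V' ->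
    expR (a + p) + expR (b - q) <= U' + V'.
  move=> t0 s0; rewrite !ler_norml => /andP[p1 p2] /andP[q1 q2].
  have [ts|ts] := leP s' t'.
  - rewrite ger0_norm ?subr_ge0// => /andP[d1 d2] aU' _ _ bV'.
    have d : s' - q <= t' - p by lra.
    have : b - s' <= a + p by lra.
    move/(@ler_expRB _ _ (s' - q) (t' - p)).
    have -> : b - s' + (s' - q) = b - q by ring.
    have -> : a + p + (t' - p) = a + t' by ring.
    by rewrite subr_ge0 => /(_ q2 d); lra.
  - rewrite ltr0_norm ?subr_lt0// => /andP[d1 d2] _ bU' aV' _.
    have d : t' + p <= s' + q by lra.
    have d0 : 0 <= t' + p by lra.
    have : a - t' <= b - q by lra.
    move/(@ler_expRB _ _ (t' + p) (s' + q)).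
    have -> : a - t' + (t' + p) = a + p by ring.
    have -> : b - q + (s' + q) = b + s' by ring.
    by move=> /(_ d0 d); lra.
(* Opposite signs are bounded term by term; when both are negative, negating [t] and [s] exchanges
   the roles of [U] and [V]. *)
have [t0|t0] := leP 0 t; have [s0|s0] := leP 0 s.
- by apply: (nonneg t s); rewrite ?(ger0_norm t0) ?(ger0_norm s0) in pt qs *.
- apply: lerD; [apply: le_trans aU|apply: le_trans bV]; rewrite ler_expR lerD2l.
    by move: pt; rewrite (ger0_norm t0) ler_norml; lra.
  by move: qs; rewrite (ltr0_norm s0) ler_norml; lra.
- rewrite addrC; apply: lerD; [apply: le_trans bU|apply: le_trans aV];
    rewrite ler_expR lerD2l.
    by move: qs; rewrite (ger0_norm s0) ler_norml; lra.
  by move: pt; rewrite (ltr0_norm t0) ler_norml; lra.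
- rewrite [leRHS]addrC; apply: (nonneg (- t) (- s)).
  all: rewrite ?oppr_ge0 ?opprK ?(ltW t0) ?(ltW s0)//.
  + by rewrite -(ltr0_norm t0).
  + by rewrite -(ltr0_norm s0).
  + by rewrite (addrC (- t)) (distrC s).
Qed.

End ExponentialMoments.

(** * Maxima of exponentials: contraction and symmetrization for one draw *)

Section MaxExp.
Variables (R : realType) (I : finType).
Implicit Types A L p t : I -> R.

(** A supremum of an exponentiated process over a finite index; exponentials being positive, the
    base value 0 shows only when [I] is empty. *)
Definition maxexp A : R := \big[Num.max/0]_i expR (A i).

Lemma expR_le_maxexp A i : expR (A i) <= maxexp A.
Proof. exact: (le_bigmax 0 (fun j => expR (A j))). Qed.

Lemma maxexp_le A (c : R) : 0 <= c -> (forall i, expR (A i) <= c) -> maxexp A <= c.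
Proof. by move=> c0 Ac; apply: bigmax_le. Qed.

Lemma maxexp_ge0 A : 0 <= maxexp A.
Proof.
exact: bigmax_ge_id.
Qed.

Lemma eq_maxexp A A' : A =1 A' -> maxexp A = maxexp A'.
Proof. by move=> AA'; apply: eq_bigr => i _; rewrite AA'. Qed.

(** The two maxima may sit at different indices, hence the bound over all pairs; one maximum is
    removed at a time, and [0 <= c] covers an empty [I]. *)
Lemma maxexp_add_le A A' (c : R) : 0 <= c ->
  (forall i j, expR (A i) + expR (A' j) <= c) -> maxexp A + maxexp A' <= c.
Proof.
move=> c0 AA'; rewrite -lerBrDr.
apply: maxexp_le => [|i].
  rewrite subr_ge0; apply: maxexp_le => // j.
  by apply: le_trans (AA' j j); rewrite lerDr expR_ge0.
rewrite lerBrDr addrC -lerBrDr.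
apply: maxexp_le => [|j]; last by rewrite lerBrDr addrC.
by rewrite subr_ge0; apply: le_trans (AA' i i); rewrite lerDl expR_ge0.
Qed.

(** The contraction principle for a single random sign, whose two values give the two summands. *)
Lemma maxexp_contraction A p t :
  (forall i, `|p i| <= `|t i|) -> (forall i j, `|p i - p j| <= `|t i - t j|) ->
  maxexp (fun i => A i + p i) + maxexp (fun i => A i - p i) <=
  maxexp (fun i => A i + t i) + maxexp (fun i => A i - t i).
Proof.
move=> pt pt2; apply: maxexp_add_le => [|i j].
  by rewrite addr_ge0 ?maxexp_ge0.
apply: (@expR_contraction2 _ _ _ (t i) (t j)) => //.
- exact: (expR_le_maxexp (fun i => A i + t i)).
- exact: (expR_le_maxexp (fun i => A i + t i)).
- exact: (expR_le_maxexp (fun i => A i - t i)).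
- exact: (expR_le_maxexp (fun i => A i - t i)).
Qed.

(** Jensen pulls the mean over an independent copy [y] out of the exponential. Midpoint convexity
    then separates [l y i] from [l x i], which doubles both and leaves terms depending on [y] or [x]
    alone. *)
Lemma maxexp_symmetrization (X : finType) (mu : X -> R) (l : X -> I -> R) A :
  (forall x, 0 <= mu x) -> \sum_x mu x = 1 ->
  2 * (\sum_x mu x * maxexp (fun i => A i + (\sum_y mu y * l y i - l x i))) <=
  \sum_x mu x * (maxexp (fun i => A i + 2 * l x i) + maxexp (fun i => A i - 2 * l x i)).
Proof.
move=> mu0 mu1.
set P := fun y => maxexp (fun i => A i + 2 * l y i).
set N := fun x => maxexp (fun i => A i - 2 * l x i).
have step x : 2 * maxexp (fun i => A i + (\sum_y mu y * l y i - l x i)) <=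
    \sum_y mu y * (P y + N x).
  rewrite mulrC -ler_pdivlMr//; apply: maxexp_le => [|i].
    rewrite divr_ge0// sumr_ge0// => y _.
    by rewrite mulr_ge0// addr_ge0// maxexp_ge0.
  rewrite ler_pdivlMr// mulrC.
  have -> : A i + (\sum_y mu y * l y i - l x i) =
      \sum_y mu y * (A i + l y i - l x i).
    rewrite [RHS](eq_bigr (fun y => mu y * l y i + mu y * (A i - l x i))); last first.
      by move=> y _; ring.
    by rewrite big_split/= -mulr_suml mu1; ring.
  apply: (@le_trans _ _ (2 * \sum_y mu y * expR (A i + l y i - l x i))).
    by rewrite ler_pM2l// expR_jensen.
  rewrite mulr_sumr; apply: ler_sum => y _.
  rewrite mulrCA ler_wpM2l//.
  have -> : A i + l y i - l x i = ((A i + 2 * l y i) + (A i - 2 * l x i)) / 2.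
    by field.
  apply: le_trans (expR_midpoint _ _) _; apply: lerD.
    exact: (expR_le_maxexp (fun i => A i + 2 * l y i)).
  exact: (expR_le_maxexp (fun i => A i - 2 * l x i)).
rewrite mulr_sumr.
have -> : \sum_x mu x * (P x + N x) = \sum_x mu x * \sum_y mu y * (P y + N x).
  under [RHS]eq_bigr => x _.
    under eq_bigr do rewrite mulrDr.
    rewrite big_split/= -mulr_suml mu1 mul1r mulrDr.
    over.
  rewrite [RHS]big_split/= -mulr_suml mu1 mul1r -big_split/=.
  by apply: eq_bigr => x _; rewrite mulrDr.
by apply: ler_sum => x _; rewrite mulrCA ler_wpM2l.
Qed.

(** The two summands of the symmetrized bound are the values of a fair sign, carried by the [bool]
    component; contraction then trades [l] for [t]. *)
Lemma maxexp_symmetrization_contraction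
    (X : finType) (mu : X -> R) (l t : X -> I -> R) A :
  (forall x, 0 <= mu x) -> \sum_x mu x = 1 ->
  (forall x i, `|l x i| <= `|t x i|) ->
  (forall x i j, `|l x i - l x j| <= `|t x i - t x j|) ->
  \sum_x mu x * maxexp (fun i => A i + (\sum_y mu y * l y i - l x i)) <=
  \sum_(y : X * bool) mu y.1 / 2 * maxexp (fun i => A i + spin y.2 * (2 * t y.1 i)).
Proof.
move=> mu0 mu1 lt lt2.
rewrite -(@ler_pM2l _ 2)//; apply: le_trans (maxexp_symmetrization l A mu0 mu1) _.
rewrite -(pair_bigA _ (fun x b =>
  mu x / 2 * maxexp (fun i => A i + spin b * (2 * t x i))))/= mulr_sumr.
apply: ler_sum => x _.
rewrite big_bool/= /spin -mulrDr mulrA [2 * _]mulrC divfK//.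
rewrite ler_wpM2l//.
under [X in _ <= X + _]eq_maxexp do rewrite mul1r.
under [X in _ <= _ + X]eq_maxexp do rewrite mulN1r.
apply: maxexp_contraction => [i|i j]; first by rewrite !normrM ler_wpM2l.
by rewrite -!mulrBr !normrM ler_wpM2l.
Qed.

End MaxExp.

(** * Passing from one draw to independent draws *)

Section ProductMeasure.
Variable R : realType.

(** Splits off the first draw, turning a sum over samples into an iterated sum for induction on the
    sample size. *)
Definition fcons (X : finType) (M : nat) (x : X) (s : {ffun 'I_M -> X}) :
    {ffun 'I_M.+1 -> X} :=
  [ffun k => if unlift ord0 k is Some j then s j else x].

Lemma fcons0 (X : finType) M (x : X) (s : {ffun 'I_M -> X}) : fcons x s ord0 = x.
Proof. by rewrite ffunE unlift_none. Qed.

Lemma fconsS (X : finType) M (x : X) (s : {ffun 'I_M -> X}) k :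
  fcons x s (lift ord0 k) = s k.
Proof. by rewrite ffunE liftK. Qed.

Lemma sum_fcons (X : finType) M (F : {ffun 'I_M.+1 -> X} -> R) :
  \sum_s F s = \sum_x \sum_(s : {ffun 'I_M -> X}) F (fcons x s).
Proof.
rewrite pair_bigA/= (reindex (fun p : X * {ffun 'I_M -> X} => fcons p.1 p.2))//=.
exists (fun s => (s ord0, [ffun k => s (lift ord0 k)])) => [[x s] _|s _] /=.
  by rewrite fcons0; congr pair; apply/ffunP => k; rewrite ffunE fconsS.
apply/ffunP => k; rewrite ffunE; case: unliftP => [j ->|->//].
by rewrite ffunE.
Qed.

(** The one-draw inequality is assumed for every offset [A], so the other draws can be frozen into
    the offset and the draws replaced one at a time. *)
Lemma maxexp_tensorization (I X Y : finType) (mu : X -> R) (nu : Y -> R)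
    (a : X -> I -> R) (b : Y -> I -> R) M (A : I -> R) :
  (forall x, 0 <= mu x) -> (forall y, 0 <= nu y) ->
  (forall A, \sum_x mu x * maxexp (fun i => A i + a x i) <=
             \sum_y nu y * maxexp (fun i => A i + b y i)) ->
  \sum_(s : {ffun 'I_M -> X}) (\prod_k mu (s k)) *
    maxexp (fun i => A i + \sum_k a (s k) i) <=
  \sum_(s : {ffun 'I_M -> Y}) (\prod_k nu (s k)) *
    maxexp (fun i => A i + \sum_k b (s k) i).
Proof.
move=> mu0 nu0 ab; elim: M A => [|M IH] A.
  rewrite le_eqVlt; apply/orP; left; apply/eqP.
  have e (Z : finType) (F : {ffun 'I_0 -> Z} -> R) c :
      (forall s, F s = c) -> \sum_s F s = c.
    move=> Fc; rewrite (eq_bigr (fun=> c))// sumr_const card_ffun card_ord expn0.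
    by rewrite mulr1n.
  rewrite !(e _ _ (maxexp A))// => s; rewrite big_ord0 mul1r;
    by apply: eq_maxexp => i; rewrite big_ord0 addr0.
rewrite !sum_fcons.
have ext (Z : finType) (c : Z -> I -> R) z (s : {ffun 'I_M -> Z}) :
    maxexp (fun i => A i + \sum_k c (fcons z s k) i) =
    maxexp (fun i => A i + c z i + \sum_k c (s k) i).
  apply: eq_maxexp => i; rewrite big_ord_recl fcons0 addrA.
  by congr (_ + _); apply: eq_bigr => k _; rewrite fconsS.
have prod (Z : finType) (c : Z -> R) z (s : {ffun 'I_M -> Z}) :
    \prod_k c (fcons z s k) = c z * \prod_k c (s k).
  rewrite big_ord_recl fcons0; congr (_ * _).
  by apply: eq_bigr => k _; rewrite fconsS.
(* Hybrid: the first draw still follows [mu], the others already [nu]. The induction hypothesis is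
   used at offset [A + a x]; what remains is the one-draw inequality with the other draws in the
   offset. *)
apply: (@le_trans _ _ (\sum_x mu x * \sum_(s : {ffun 'I_M -> Y})
    (\prod_k nu (s k)) * maxexp (fun i => A i + a x i + \sum_k b (s k) i))).
  apply: ler_sum => x _; under eq_bigr do rewrite ext prod -mulrA.
  by rewrite -mulr_sumr ler_wpM2l// IH.
under eq_bigr do rewrite mulr_sumr.
rewrite exchange_big [leRHS]exchange_big/=; apply: ler_sum => s _.
under eq_bigr do rewrite mulrCA.
under [leRHS]eq_bigr do rewrite ext prod mulrAC [_ * _ * _]mulrC.
rewrite -!mulr_sumr ler_wpM2l ?prodr_ge0//.
have swap (Z : finType) (c : Z -> I -> R) z :
    maxexp (fun i => A i + c z i + \sum_k b (s k) i) =
    maxexp (fun i => (A i + \sum_k b (s k) i) + c z i).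
  by apply: eq_maxexp => i; rewrite addrAC.
under eq_bigr do rewrite swap.
under [leRHS]eq_bigr do rewrite swap.
exact: ab.
Qed.

End ProductMeasure.

(** * Uniform deviation over an l1 ball *)

Section UniformDeviation.
Variable R : realType.

(** A linear form on the l1 ball is at most its value at a vertex, here the one with the largest [G]
    in modulus; the right side sums over all vertices. [k0] ensures that there is one. *)
Lemma expR_dot_le (K : finType) (P : pred K) (k0 : K) (v G : K -> R) (r : R) :
  P k0 -> \sum_(k | P k) `|v k| <= r ->
  expR (\sum_(k | P k) v k * G k) <=
  \sum_(k | P k) (expR (r * G k) + expR (- r * G k)).
Proof.
move=> Pk0 vr.
have [j Pj maxj] := @arg_maxP _ _ _ k0 P (fun k => `|G k|) Pk0.
have r0 : 0 <= r by apply: le_trans vr; apply: sumr_ge0.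
apply: (@le_trans _ _ (expR (r * G j) + expR (- r * G j))); last first.
  rewrite (bigD1 j)//= lerDl; apply: sumr_ge0 => k _.
  by rewrite addr_ge0// expR_ge0.
have : \sum_(k | P k) v k * G k <= r * `|G j|.
  apply: (@le_trans _ _ (\sum_(k | P k) `|v k| * `|G j|)).
    apply: ler_sum => k Pk; rewrite (le_trans (ler_norm _))// normrM.
    by rewrite ler_wpM2l//; exact: maxj.
  by rewrite -mulr_suml ler_wpM2r.
rewrite -ler_expR => /le_trans; apply.
case: (ger0P (G j)) => _; first by rewrite lerDl expR_ge0.
by rewrite mulrN mulNr lerDr expR_ge0.
Qed.

(** Independence factors the moment over the draws; each factor averages hyperbolic cosines of
    [c * z x], at most [expR (c ^+ 2)]. *)
Lemma rademacher_moment (X : finType) (mu z : X -> R) (c : R) M :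
  (forall x, 0 <= mu x) -> \sum_x mu x = 1 -> (forall x, `|z x| <= 1) ->
  \sum_(s : {ffun 'I_M -> X * bool}) (\prod_k (mu (s k).1 / 2)) *
    expR (c * \sum_k spin (s k).2 * z (s k).1) <= expR (M%:R * c ^+ 2).
Proof.
move=> mu0 mu1 z1.
pose F (y : X * bool) : R := mu y.1 / 2 * expR (c * (spin y.2 * z y.1)).
rewrite (eq_bigr (fun s : {ffun 'I_M -> X * bool} => \prod_k F (s k))); last first.
  by move=> s _; rewrite mulr_sumr expR_sum -big_split.
rewrite -(bigA_distr_bigA (fun (_ : 'I_M) y => F y)) prodr_const card_ord.
rewrite expRM_natl lerXn2r ?nnegrE ?expR_ge0//.
  by apply: sumr_ge0 => y _; rewrite mulr_ge0 ?expR_ge0// divr_ge0.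
rewrite -(pair_bigA _ (fun x b => F (x, b)))/=.
apply: (@le_trans _ _ (\sum_x mu x * expR (c ^+ 2))); last first.
  by rewrite -mulr_suml mu1 mul1r.
apply: ler_sum => x _; rewrite big_bool /F/= /spin -mulrDr -mulrA ler_wpM2l//.
rewrite mul1r mulN1r mulrN mulrC ler_pdivrMr// [leRHS]mulrC.
apply: le_trans (cosh_le_expR_sqr _) _.
rewrite ler_pM2l// ler_expR exprMn ler_piMr ?sqr_ge0//.
by rewrite -(ger0_norm (sqr_ge0 _)) normrX expr_le1.
Qed.

Variables (X I K : finType) (mu : X -> R) (P : pred K) (k0 : K).
Variables (z : X -> K -> R) (v : I -> K -> R) (l : X -> I -> R) (r : R).
Hypotheses (mu0 : forall x, 0 <= mu x) (mu1 : \sum_x mu x = 1).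
Hypothesis Pk0 : P k0.
Hypothesis z1 : forall x k, `|z x k| <= 1.
Hypothesis vr : forall i, \sum_(k | P k) `|v i k| <= r.
Let t x i := \sum_(k | P k) v i k * z x k.
Hypothesis lt : forall x i, `|l x i| <= `|t x i|.
Hypothesis lt2 : forall x i j, `|l x i - l x j| <= `|t x i - t x j|.
Let L i := \sum_x mu x * l x i.

(** Symmetrization and contraction, tensorized, replace the loss by the linear form [t], and only
    the [2 * #|P|] vertices matter. The scale [2 * r * lam] is the l1 radius times the 2 from
    symmetrization. *)
Lemma deviation_moment M (lam : R) : 0 <= lam ->
  \sum_(s : {ffun 'I_M -> X}) (\prod_k mu (s k)) *
    maxexp (fun i => lam * \sum_k (L i - l (s k) i)) <=
  2 * #|P|%:R * expR (M%:R * (2 * r * lam) ^+ 2).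
Proof.
move=> lam0.
pose a x i := \sum_y mu y * (lam * l y i) - lam * l x i.
pose b (y : X * bool) i : R := spin y.2 * (2 * (lam * t y.1 i)).
have step A : \sum_x mu x * maxexp (fun i => A i + a x i) <=
    \sum_y mu y.1 / 2 * maxexp (fun i => A i + b y i).
  apply: (@maxexp_symmetrization_contraction _ _ _ mu (fun x i => lam * l x i)
    (fun x i => lam * t x i)) => // [x i|x i j].
    by rewrite !normrM ler_wpM2l.
  by rewrite -!mulrBr !normrM ler_wpM2l.
have nu0 (y : X * bool) : 0 <= mu y.1 / 2 by rewrite divr_ge0.
have := maxexp_tensorization M (fun=> 0) mu0 nu0 step.
rewrite (eq_bigr (fun s : {ffun 'I_M -> X} => (\prod_k mu (s k)) *
    maxexp (fun i => lam * \sum_k (L i - l (s k) i)))); last first.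
  move=> s _; congr (_ * _); apply: eq_maxexp => i.
  rewrite add0r mulr_sumr; apply: eq_bigr => k _.
  rewrite /a mulrBr; congr (_ - _); rewrite mulr_sumr.
  by apply: eq_bigr => x _; rewrite mulrCA.
move=> /le_trans; apply.
pose G q (s : {ffun 'I_M -> X * bool}) : R := \sum_k spin (s k).2 * z (s k).1 q.
have bound (s : {ffun 'I_M -> X * bool}) : maxexp (fun i => 0 + \sum_k b (s k) i) <=
    \sum_(q | P q) (expR (2 * r * lam * G q s) + expR (- (2 * r * lam) * G q s)).
  apply: maxexp_le => [|i].
    by apply: sumr_ge0 => q _; rewrite addr_ge0// expR_ge0.
  have -> : 0 + \sum_k b (s k) i = \sum_(q | P q) v i q * (2 * lam * G q s).
    rewrite add0r /b /t.
    under eq_bigr do rewrite !mulr_sumr.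
    rewrite exchange_big/=; apply: eq_bigr => q _.
    by rewrite !mulr_sumr; apply: eq_bigr => k _; ring.
  apply: le_trans (expR_dot_le _ Pk0 (vr i)) _.
  rewrite le_eqVlt; apply/orP; left; apply/eqP; apply: eq_bigr => q _.
  by congr (expR _ + expR _); ring.
apply: (@le_trans _ _ (\sum_(s : {ffun 'I_M -> X * bool}) (\prod_k (mu (s k).1 / 2)) *
    \sum_(q | P q) (expR (2 * r * lam * G q s) + expR (- (2 * r * lam) * G q s)))).
  by apply: ler_sum => s _; rewrite ler_wpM2l// prodr_ge0.
under eq_bigr do rewrite mulr_sumr.
rewrite exchange_big/=.
apply: (@le_trans _ _ (\sum_(q | P q) 2 * expR (M%:R * (2 * r * lam) ^+ 2))); last first.
  by rewrite sumr_const -[leLHS]mulr_natl mulrCA mulrA.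
apply: ler_sum => q _.
under eq_bigr do rewrite mulrDr.
rewrite big_split/= [leRHS]mulr_natl [leRHS]mulr2n; apply: lerD.
  exact: (@rademacher_moment _ mu (fun x => z x q)).
by rewrite -(sqrrN (2 * r * lam)); apply: (@rademacher_moment _ mu (fun x => z x q)).
Qed.

(** Markov's inequality: each bad sample contributes at least [expR (lam * (M%:R * eps))] to the
    exponential moment. *)
Lemma uniform_deviation M (eps : R) (B : pred {ffun 'I_M -> X}) :
  0 < r -> 0 <= eps ->
  (forall s, B s -> exists i, M%:R * eps <= \sum_k (L i - l (s k) i)) ->
  \sum_(s | B s) \prod_k mu (s k) <=
  2 * #|P|%:R * expR (- (M%:R * eps ^+ 2 / (16 * r ^+ 2))).
Proof.
move=> r0 eps0 Bdev; pose lam := eps / (8 * r ^+ 2).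
(* This [lam] minimizes [4 * r ^+ 2 * lam ^+ 2 - lam * eps]. *)
have lam0 : 0 <= lam by rewrite divr_ge0// mulr_ge0// sqr_ge0.
have -> : - (M%:R * eps ^+ 2 / (16 * r ^+ 2)) =
    M%:R * (2 * r * lam) ^+ 2 - lam * (M%:R * eps).
  by rewrite /lam; field; rewrite lt0r_neq0.
rewrite expRB mulrA ler_pdivlMr ?expR_gt0//.
apply: le_trans (deviation_moment M lam0).
rewrite mulr_suml big_mkcond/=; apply: ler_sum => s _.
case: ifP => [/Bdev[i Mi]|_]; last first.
  by rewrite mulr_ge0 ?prodr_ge0// maxexp_ge0.
rewrite ler_wpM2l ?prodr_ge0//.
apply: le_trans (expR_le_maxexp (fun i => lam * \sum_k (L i - l (s k) i)) i).
by rewrite ler_expR ler_wpM2l.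
Qed.

End UniformDeviation.

(** * Characters and coordinate flips on the cube *)

Section Cube.
Variables (R : realType) (n : nat).
Implicit Types (T nu : {set 'I_n}) (x y : cube n) (u : 'I_n).

Lemma spin_sqr (b : bool) : spin b * spin b = 1 :> R.
Proof. by case: b; rewrite /spin ?mulr1// mulrNN mulr1. Qed.

Lemma norm_spin (b : bool) : `|spin b| = 1 :> R.
Proof. by case: b; rewrite /spin ?normrN normr1. Qed.

Lemma norm_chi T x : `|chi R T x| = 1.
Proof. by rewrite /chi normr_prod big1// => i _; rewrite norm_spin. Qed.

Lemma setx_id x u : setx x u (x u) = x.
Proof. by apply/ffunP => i; rewrite ffunE; case: eqP => [->|]. Qed.

Lemma setx_at x u b : setx x u b u = b.
Proof. by rewrite ffunE eqxx. Qed.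

Lemma setx_setx x u b c : setx (setx x u b) u c = setx x u c.
Proof. by apply/ffunP => i; rewrite !ffunE; case: eqP. Qed.

Lemma chi_setx_notin T x u b : u \notin T -> chi R T (setx x u b) = chi R T x.
Proof.
move=> uT; apply: eq_bigr => i iT; rewrite ffunE; case: eqP => // iu.
by rewrite -iu iT in uT.
Qed.

Lemma chi_setx T x u b : u \in T ->
  chi R T (setx x u b) = spin b * chi R (T :\ u) x.
Proof.
move=> uT; rewrite -(chi_setx_notin x b (T := T :\ u) (u := u)) ?setD11//.
by rewrite /chi (big_setD1 u)//= setx_at.
Qed.

(** The sum is the expansion of a product over coordinates, in which a coordinate where [x] and [y]
    differ gives a zero factor. *)
Lemma sum_chi_chi x y : \sum_T chi R T y * chi R T x = (x == y)%:R * 2 ^+ n.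
Proof.
transitivity (\prod_(i < n) (spin (y i) * spin (x i) + 1) : R).
  rewrite bigA_distr; apply: eq_bigr => T _.
  by rewrite -big_mkcond /chi big_split.
have [->|/eqP xy] := eqVneq x y.
  by rewrite mul1r (eq_bigr (fun=> 2)) ?prodr_const ?card_ord// => i _; rewrite spin_sqr.
rewrite mul0r; have /existsP[i xyi] : [exists i, x i != y i].
  rewrite -negb_forall; apply/negP => /forallP H; apply: xy; apply/ffunP => i.
  exact/eqP/H.
rewrite (bigD1 i)//=; move: xyi; rewrite /spin.
by case: (x i); case: (y i) => //= _; rewrite ?mulr1 ?mul1r addrC subrr mul0r.
Qed.

(** Flipping coordinate [u] is an involution, which reindexes one of the two copies of the sum. *)
Lemma sum_setx (H : cube n -> R) u :
  \sum_x (H (setx x u true) + H (setx x u false)) = 2 * \sum_x H x.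
Proof.
pose flip x := setx x u (~~ x u).
have flipK : involutive flip.
  by move=> x; rewrite /flip setx_at negbK setx_setx setx_id.
rewrite mulr_natl mulr2n [X in _ = _ + X](reindex_inj (inv_inj flipK))/= -big_split/=.
apply: eq_bigr => x _; rewrite /flip -{3}(setx_id x u).
by case: (x u) => //=; rewrite addrC.
Qed.

Lemma dotz_setx nu u (w : {set 'I_n} -> R) x b :
  u \notin nu -> dotz nu w (setx x u b) = dotz nu w x.
Proof.
move=> unu; apply: eq_bigr => T Tnu; rewrite chi_setx_notin//.
by apply: contra unu; apply: (fintype.subsetP Tnu).
Qed.

Lemma dotzB nu (w w' : {set 'I_n} -> R) x :
  dotz nu w x - dotz nu w' x = \sum_(T : {set 'I_n} | T \subset nu) (w T - w' T) * chi R T x.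
Proof. by rewrite -sumrB; apply: eq_bigr => T _; rewrite mulrBl. Qed.

(** Matches features indexed by subsets of [nu] with the Fourier terms containing [u] that they come
    from. *)
Lemma sum_subset_setU1 nu u (F : {set 'I_n} -> R) : u \notin nu ->
  \sum_(S : {set 'I_n} | S \subset nu) F S =
  \sum_(T : {set 'I_n} | (u \in T) && (T :\ u \subset nu)) F (T :\ u).
Proof.
move=> unu; rewrite (reindex_onto (fun T => T :\ u) (fun S => u |: S)); last first.
  move=> S Snu; rewrite setU1K//.
  by apply: contra unu; apply: (fintype.subsetP Snu).
apply: eq_bigl => T; rewrite andbC; congr (_ && _).
have [uT|uT] := boolP (u \in T); first by rewrite finset.setD1K// eqxx.
by apply/eqP => E; move: uT; rewrite -E setU11.
Qed.

End Cube.

(** * The RBM marginal, its logistic conditionals and the excess risk *)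

Section RBM.
Variables (R : realType) (n m : nat).
Variables (J : 'I_n -> 'I_m -> R) (h : 'I_n -> R) (g : 'I_m -> R).
Implicit Types (T nu : {set 'I_n}) (x y : cube n) (u : 'I_n).
Local Notation f := (rbm_f J h g).
Local Notation fhat := (fhat J h g).
Local Notation mu := (rbm_marg J h g).
Local Notation Z := (rbm_Z J h g).
Local Notation condp := (condp J h g).

(** For fixed [x] the weight factors over the hidden units, and summing out each one produces one
    [rho] term. *)
Lemma sum_rbm_weight x : \sum_y rbm_weight J h g x y = expR (f x).
Proof.
pose c j := \sum_i J i j * spin (x i) + g j.
have wE (y : cube m) : rbm_weight J h g x y =
    (\prod_j expR (c j * spin (y j))) * expR (\sum_i h i * spin (x i)).
  rewrite -expR_sum -expRD /rbm_weight; congr expR.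
  rewrite addrAC exchange_big -big_split/=; congr (_ + _).
  apply: eq_bigr => j _; rewrite mulrDl mulr_suml; congr (_ + _).
  by apply: eq_bigr => i _; rewrite (mulrC (J i j)).
under eq_bigr do rewrite wE.
rewrite -mulr_suml -(bigA_distr_bigA (fun j b => expR (c j * spin b))).
rewrite /rbm_f expRD expR_sum; congr (_ * _); apply: eq_bigr => j _.
by rewrite big_bool/= /spin mulr1 mulrN1 /rho lnK// posrE addr_gt0 ?expR_gt0.
Qed.

Lemma rbm_Z_gt0 : 0 < Z.
Proof.
rewrite /rbm_Z; under eq_bigr do rewrite sum_rbm_weight.
rewrite (bigD1 [ffun=> true])//= ltr_wpDr ?expR_gt0//.
by apply: sumr_ge0 => *; apply: expR_ge0.
Qed.

Lemma rbm_margE x : mu x = expR (f x) / Z.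
Proof. by rewrite /rbm_marg sum_rbm_weight. Qed.

Lemma rbm_marg_gt0 x : 0 < mu x.
Proof. by rewrite rbm_margE divr_gt0 ?expR_gt0 ?rbm_Z_gt0. Qed.

Lemma rbm_marg_ge0 x : 0 <= mu x.
Proof. exact/ltW/rbm_marg_gt0. Qed.

Lemma sum_rbm_marg : \sum_x mu x = 1.
Proof. by rewrite -mulr_suml divff// lt0r_neq0// rbm_Z_gt0. Qed.

(** Fourier inversion, from the orthogonality relation [sum_chi_chi]. *)
Lemma rbm_f_fourier x : f x = \sum_T fhat T * chi R T x.
Proof.
under eq_bigr do rewrite /Defs.fhat -mulrA mulr_suml.
rewrite -mulr_sumr exchange_big/=.
under eq_bigr => y _.
  under eq_bigr do rewrite -mulrA.
  rewrite -mulr_sumr sum_chi_chi; over.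
rewrite (bigD1 x)//= eqxx mul1r big1 ?addr0; last first.
  by move=> y yx; rewrite eq_sym (negbTE yx) mul0r mulr0.
by rewrite mulrCA mulVf ?mulr1// expf_neq0.
Qed.

(** The factor 2 arises because a character containing [u] changes sign when [x u] is flipped. *)
Definition log_odds u x := \sum_(T : {set 'I_n} | u \in T) 2 * fhat T * chi R (T :\ u) x.

Lemma rbm_fB_setx u x : f (setx x u true) - f (setx x u false) = log_odds u x.
Proof.
rewrite !rbm_f_fourier -sumrB [LHS](bigID (fun T => u \in T))/= [X in _ + X]big1.
  rewrite addr0; apply: eq_bigr => T uT; rewrite !chi_setx// /spin; ring.
by move=> T uT; rewrite !chi_setx_notin// subrr.
Qed.

Lemma condpE u x : condp u x = sigmoid (log_odds u x).
Proof.
rewrite -rbm_fB_setx /Defs.condp !rbm_margE /sigmoid opprB expRB.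
have := rbm_Z_gt0; have := expR_gt0 (f (setx x u true)).
have := expR_gt0 (f (setx x u false)) => f0 t0 Z0.
by field; rewrite ?lt0r_neq0 ?addr_gt0.
Qed.

Lemma condp_setx u x b : condp u (setx x u b) = condp u x.
Proof. by rewrite /Defs.condp !setx_setx. Qed.

(** Resampling the spin at [u] from its conditional law preserves the marginal. Doubling both sums
    pairs the configurations that differ at [u]. *)
Lemma rbm_marg_cond_expectation u (G : cube n -> R) :
  \sum_x mu x * G x = \sum_x mu x *
    (condp u x * G (setx x u true) + (1 - condp u x) * G (setx x u false)).
Proof.
apply: (@mulfI _ 2) => //; rewrite -!(@sum_setx _ _ _ u).
apply: eq_bigr => x _; rewrite !setx_setx !condp_setx /Defs.condp.
have := rbm_marg_gt0 (setx x u true); have := rbm_marg_gt0 (setx x u false) => f0 t0.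
by field; rewrite lt0r_neq0// addr_gt0.
Qed.

Definition logistic_loss nu u (w : {set 'I_n} -> R) x : R :=
  softplus (- (spin (x u) * dotz nu w x)).

Definition risk nu u (w : {set 'I_n} -> R) : R := \sum_x mu x * logistic_loss nu u w x.

(** Conditioning on the other spins and [softplusN] merge the losses of the two labels. *)
Lemma riskE nu u w : u \notin nu ->
  risk nu u w = \sum_x mu x * (softplus (dotz nu w x) - condp u x * dotz nu w x).
Proof.
move=> unu; rewrite /risk (rbm_marg_cond_expectation u); apply: eq_bigr => x _; congr (_ * _).
rewrite /logistic_loss !setx_at !dotz_setx// /spin mulN1r opprK mul1r softplusN; ring.
Qed.

(** The difference of risks is a difference of mean Bregman divergences from the true log-odds; the
    lower bound is used at [w], the upper one at [w']. *)
Lemma pred_err_le_excess_risk nu u w w' : u \notin nu ->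
  2 * pred_err J h g nu u w <= risk nu u w - risk nu u w' +
    \sum_x mu x * ((dotz nu w' x - log_odds u x) ^+ 2 / 4).
Proof.
move=> unu; rewrite !riskE// /pred_err mulr_sumr -sumrB -big_split/=.
apply: ler_sum => x _; rewrite -mulrBr -mulrDr mulrCA ler_wpM2l ?rbm_marg_ge0//.
have := softplus_bregman_ge (log_odds u x) (dotz nu w x).
have := softplus_bregman_le (log_odds u x) (dotz nu w' x).
by rewrite -condpE -[in X in _ -> X -> _](sqrrN (_ - _)) opprB; lra.
Qed.

Lemma sum_fhat_le_gamma u :
  \sum_(T : {set 'I_n} | u \in T) `|fhat T| <= rbm_gamma J h g.
Proof.
exact: (le_bigmax 0 (fun u => \sum_(T : {set 'I_n} | u \in T) `|fhat T|)).
Qed.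

(** The comparator: the true log-odds coefficients, indexed by [T :\ u] rather than [T]. *)
Definition fourier_weights u (S : {set 'I_n}) : R := 2 * fhat (u |: S).

Lemma dotz_fourier_weights nu u x : u \notin nu ->
  dotz nu (fourier_weights u) x =
  \sum_(T : {set 'I_n} | (u \in T) && (T :\ u \subset nu)) 2 * fhat T * chi R (T :\ u) x.
Proof.
move=> unu; rewrite /dotz (sum_subset_setU1 _ unu).
by apply: eq_bigr => T /andP[uT _]; rewrite /fourier_weights finset.setD1K.
Qed.

Lemma l1w_fourier_weights nu u : u \notin nu ->
  l1w nu (fourier_weights u) <= 2 * rbm_gamma J h g.
Proof.
move=> unu; rewrite /l1w (sum_subset_setU1 _ unu).
apply: (@le_trans _ _ (2 * \sum_(T : {set 'I_n} | u \in T) `|fhat T|)); last first.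
  by rewrite ler_pM2l// sum_fhat_le_gamma.
rewrite mulr_sumr big_mkcondr/=; apply: ler_sum => T uT.
by case: ifP => _; rewrite ?mulr_ge0// /fourier_weights finset.setD1K// normrM ger0_norm.
Qed.

(** Every dropped [T] contains some [i] outside [nu], so its coefficient is below [zeta]; at most
    [rbm_psi] of these coefficients are nonzero. *)
Lemma truncation_error nu u (zeta : R) x : 0 <= zeta -> u \notin nu ->
  (forall i, i != u ->
     (exists T : {set 'I_n}, [/\ u \in T, i \in T & zeta <= `|fhat T|]) -> i \in nu) ->
  `|dotz nu (fourier_weights u) x - log_odds u x| <= 2 * (zeta * (rbm_psi J h g)%:R).
Proof.
move=> zeta0 unu nuP.
have -> : dotz nu (fourier_weights u) x - log_odds u x =
    - \sum_(T : {set 'I_n} | (u \in T) && ~~ (T :\ u \subset nu))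
        2 * fhat T * chi R (T :\ u) x.
  rewrite dotz_fourier_weights// /log_odds.
  by rewrite [X in _ - X](bigID (fun T : {set 'I_n} => T :\ u \subset nu))/= opprD addNKr.
rewrite normrN; apply: le_trans (ler_norm_sum _ _ _) _.
pose B := [set T : {set 'I_n} | (u \in T) && (fhat T != 0)].
apply: (@le_trans _ _ (\sum_(T in B) 2 * zeta)); last first.
  rewrite sumr_const -[leLHS]mulr_natr -mulrA ler_pM2l// ler_wpM2l// ler_nat.
  exact: (@leq_bigmax _ (fun u => #|[set T : {set 'I_n} | (u \in T) && (fhat T != 0)]|)).
rewrite big_mkcond [leRHS]big_mkcond/=; apply: ler_sum => T _.
rewrite inE; have [uT|//] := boolP (u \in T); rewrite /=.
have [f0|f0] := eqVneq (fhat T) 0.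
  by case: ifP => //=; rewrite f0 mulr0 mul0r normr0.
case: ifPn => [/fintype.subsetPn[i]|_]; last by rewrite mulr_ge0.
rewrite !inE => /andP[iu iT] inu.
rewrite normrM norm_chi mulr1 normrM ger0_norm// ler_pM2l// leNgt.
by apply: contra inu => /ltW fz; apply: (nuP _ iu); exists T.
Qed.

End RBM.

(** * Failure probability of the regression at one variable *)

Section Failure.
Variables (R : realType) (n m : nat).
Variables (J : 'I_n -> 'I_m -> R) (h : 'I_n -> R) (g : 'I_m -> R).
Local Notation mu := (rbm_marg J h g).
Local Notation gamma := (rbm_gamma J h g).

Lemma rbm_gamma_ge0 : 0 <= gamma.
Proof. exact: bigmax_ge_id. Qed.

Lemma sum_prod_rbm_marg M : \sum_(s : {ffun 'I_M -> cube n}) \prod_k mu (s k) = 1.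
Proof.
rewrite -(bigA_distr_bigA (fun (_ : 'I_M) x => mu x)).
by rewrite big1// => k _; rewrite sum_rbm_marg.
Qed.

Lemma card_subsets_le_D (nu : {set 'I_n}) u : nu \subset mrf_nbhd J h g u ->
  (#|fun T : {set 'I_n} => T \subset nu| <= 2 ^ rbm_D J h g)%N.
Proof.
move=> nus; have -> : #|fun T : {set 'I_n} => T \subset nu| = #|powerset nu|.
  by apply: eq_card => T; rewrite !inE.
rewrite card_powerset leq_exp2l// (leq_trans (subset_leq_card nus))//.
exact: (@leq_bigmax _ (fun u => #|mrf_nbhd J h g u|)).
Qed.

Variables (nu : {set 'I_n}) (u : 'I_n) (M : nat) (eps : R).
Hypotheses (unu : u \notin nu) (eps0 : 0 < eps).
Hypothesis trunc : forall x,
  2 * (dotz nu (fourier_weights J h g u) x - log_odds J h g u x) ^+ 2 <= 4 * eps.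

(** [trunc] bounds the bias term by [eps / 2], so a doubled error above [2 * eps] leaves more than
    [eps] of excess risk. *)
Lemma excess_risk_of_pred_err w : eps < pred_err J h g nu u w ->
  eps <= risk J h g nu u w - risk J h g nu u (fourier_weights J h g u).
Proof.
move=> err.
have := pred_err_le_excess_risk J h g w (fourier_weights J h g u) unu.
set S := \sum_x _; suff : S <= eps / 2 by have := eps0; lra.
apply: (@le_trans _ _ (\sum_x mu x * (eps / 2))).
  by apply: ler_sum => x _; rewrite ler_wpM2l ?rbm_marg_ge0//; have := trunc x; lra.
by rewrite -mulr_suml sum_rbm_marg mul1r.
Qed.

Definition erm_fails (s : {ffun 'I_M -> cube n}) : bool :=
  `[< exists w, is_erm nu u (2 * gamma) s w /\ eps < pred_err J h g nu u w >].

(** The deviation bound needs a positive radius. At radius zero all admissible weights vanish, the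
    comparator included, so there is no excess risk. *)
Lemma erm_fails_gamma0 s : gamma = 0 -> ~~ erm_fails s.
Proof.
move=> gamma0; apply/negP => /asboolP[w [[w0 _] /excess_risk_of_pred_err]].
have w'0 := l1w_fourier_weights J h g unu.
have dot0 v x : l1w nu v <= 2 * gamma -> dotz nu v x = 0.
  rewrite gamma0 mulr0 => v0; rewrite /dotz big1// => T Tnu.
  have : l1w nu v == 0 by rewrite eq_le v0 sumr_ge0.
  rewrite psumr_eq0// => /allP/(_ T); rewrite mem_index_enum Tnu normr_eq0/=.
  by move=> /(_ isT)/eqP ->; rewrite mul0r.
rewrite /risk -sumrB big1; first by rewrite leNgt eps0.
by move=> x _; rewrite /logistic_loss !dot0// subrr.
Qed.

(** A minimizer has nonpositive empirical excess risk, so a failure forces a total deviation of at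
    least [M%:R * eps]. Indexing one selected vector by each sample keeps the maximum finite. *)
Lemma erm_fails_prob : 0 < gamma ->
  \sum_(s | erm_fails s) \prod_k mu (s k) <=
  2 * #|fun T : {set 'I_n} => T \subset nu|%:R *
    expR (- (M%:R * eps ^+ 2 / (256 * gamma ^+ 2))).
Proof.
move=> gamma0; set w' := fourier_weights J h g u.
have l1w' : l1w nu w' <= 2 * gamma := l1w_fourier_weights J h g unu.
(* Samples without failure receive the comparator [w'], so the l1 bound holds at every index. *)
have [wsel wselP] : {wsel : {ffun 'I_M -> cube n} -> {set 'I_n} -> R & forall s,
    l1w nu (wsel s) <= 2 * gamma /\ (erm_fails s ->
      is_erm nu u (2 * gamma) s (wsel s) /\ eps < pred_err J h g nu u (wsel s))}.
  apply: (@choice _ _ (fun s w => l1w nu w <= 2 * gamma /\ (erm_fails s ->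
      is_erm nu u (2 * gamma) s w /\ eps < pred_err J h g nu u w))) => s.
  have [/asboolP[w [ew err]]|_] := boolP (erm_fails s); last by exists w'.
  by exists w; split=> //; case: ew.
pose l (x : cube n) s : R := logistic_loss nu u (wsel s) x - logistic_loss nu u w' x.
have loss_lip v1 v2 (x : cube n) :
    `|logistic_loss nu u v1 x - logistic_loss nu u v2 x| <=
    `|spin (x u) * (dotz nu v1 x - dotz nu v2 x)|.
  apply: le_trans (softplus_lip _ _) _.
  by rewrite -opprD normrN mulrBr.
have tE s (x : cube n) : \sum_(T : {set 'I_n} | T \subset nu)
    (wsel s T - w' T) * (spin (x u) * chi R T x) =
    spin (x u) * (dotz nu (wsel s) x - dotz nu w' x).
  by rewrite dotzB mulr_sumr; apply: eq_bigr => T _; rewrite mulrCA.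
(* Both vectors lie in the ball of radius [2 * gamma], so their difference has l1 norm at most
   [4 * gamma]; hence 256. *)
have -> : 256 * gamma ^+ 2 = 16 * (4 * gamma) ^+ 2 by ring.
apply: (@uniform_deviation R (cube n) {ffun 'I_M -> cube n} {set 'I_n} mu
  (fun T => T \subset nu) finset.set0 (fun x T => spin (x u) * chi R T x)
  (fun s T => wsel s T - w' T) l (4 * gamma)) => //.
- exact: rbm_marg_ge0.
- exact: sum_rbm_marg.
- exact: finset.sub0set.
- by move=> x T; rewrite normrM norm_spin norm_chi mulr1.
- move=> s; apply: (@le_trans _ _ (l1w nu (wsel s) + l1w nu w')).
    by rewrite -big_split/=; apply: ler_sum => T _; apply: ler_normB.
  by have [] := wselP s; lra.
- by move=> x s; rewrite tE; apply: loss_lip.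
- move=> x s1 s2; rewrite !tE /l -mulrBr !opprB !addrA !subrK.
  by apply: loss_lip.
- by rewrite mulr_gt0.
- exact: ltW.
(* The index witnessing the deviation of a bad sample is the sample itself. *)
move=> s bad; exists s; have [_ /(_ bad)[[_ erm] err]] := wselP s.
rewrite big_split/= sumr_const card_ord sumrN /l sumrB.
have -> : \sum_x mu x * (logistic_loss nu u (wsel s) x - logistic_loss nu u w' x) =
    risk J h g nu u (wsel s) - risk J h g nu u w'.
  by rewrite -sumrB; apply: eq_bigr => x _; rewrite mulrBr.
have exc := excess_risk_of_pred_err err.
have emp : \sum_k logistic_loss nu u (wsel s) (s k) <= \sum_k logistic_loss nu u w' (s k).
  have := erm w' l1w'; rewrite /emp_loss.
  (* For [M = 0] the factor [M%:R^-1] is 0 and cannot be cancelled, but both sums are empty. *)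
  have [M0|M0] := posnP M; last by rewrite ler_pM2l// invr_gt0 ltr0n.
  by move=> _; rewrite !big1// => -[k kM]; exfalso; move: (kM); rewrite M0.
rewrite -[leLHS]subr0; apply: lerB; last by rewrite subr_le0.
by rewrite -[leRHS]mulr_natl ler_wpM2l.
Qed.

End Failure.

(** * Union bound over the observed variables and choice of constants *)

Theorem theorem9 (R : realType) :
  exists C : R, 0 < C /\
  forall (n m : nat) (J : 'I_n -> 'I_m -> R) (h : 'I_n -> R) (g : 'I_m -> R)
         (delta eps zeta : R) (nbr : 'I_n -> {set 'I_n}) (M : nat),
    0 < delta -> 0 < eps -> 0 < zeta ->
    (forall u, nbr u \subset mrf_nbhd J h g u) ->
    (forall u i, i != u ->
       (exists T : {set 'I_n}, [/\ u \in T, i \in T & zeta <= `|fhat J h g T|]) ->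
       i \in nbr u) ->
    C * rbm_gamma J h g ^+ 2
      * ln (8 * n%:R * 2 ^+ rbm_D J h g / delta) / eps ^+ 2 <= M%:R ->
    zeta * (rbm_psi J h g)%:R * Num.sqrt (1 + expR (2 * rbm_gamma J h g))
      <= Num.sqrt eps ->
    1 - delta <=
      sample_prob J h g (fun s : {ffun 'I_M -> cube n} =>
        forall (u : 'I_n) (w : {set 'I_n} -> R),
          is_erm (nbr u) u (2 * rbm_gamma J h g) s w ->
          pred_err J h g (nbr u) u w <= eps).
Proof.
exists 256; split=> // n m J h g delta eps zeta nbr M delta0 eps0 zeta0.
set gamma := rbm_gamma J h g => nbrs nbrP HM Hzeta.
have unbr u : u \notin nbr u.
  by apply/negP => /(fintype.subsetP (nbrs u)); rewrite inE eqxx.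
have gamma0 : 0 <= gamma := rbm_gamma_ge0 J h g.
(* The quantity [1 + expR (2 * gamma)] under the root is at least 2. *)
have zpsi : 2 * (zeta * (rbm_psi J h g)%:R) ^+ 2 <= eps.
  have a0 : 0 <= zeta * (rbm_psi J h g)%:R by rewrite mulr_ge0// ltW.
  have e1 : 1 <= expR (2 * gamma) by rewrite -expR0 ler_expR mulr_ge0.
  have : (zeta * (rbm_psi J h g)%:R * Num.sqrt (1 + expR (2 * gamma))) ^+ 2 <= eps.
    rewrite -[leRHS]sqr_sqrtr ?(ltW eps0)// lerXn2r ?nnegrE ?sqrtr_ge0//.
    by rewrite mulr_ge0// sqrtr_ge0.
  rewrite exprMn sqr_sqrtr; last by rewrite addr_ge0// expR_ge0.
  by have := sqr_ge0 (zeta * (rbm_psi J h g)%:R); nra.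
have trunc u x : 2 * (dotz (nbr u) (fourier_weights J h g u) x - log_odds J h g u x) ^+ 2
    <= 4 * eps.
  have := truncation_error x (ltW zeta0) (unbr u) (nbrP u).
  rewrite -ler_sqr ?nnegrE ?mulr_ge0 ?(ltW zeta0)// real_normK ?num_real// exprMn.
  by lra.
set Q := 8 * n%:R * 2 ^+ rbm_D J h g / delta in HM.
(* By the choice of [Q] this bound equals [delta / (4 * n)]. *)
have fail u : \sum_(s : {ffun 'I_M -> cube n} | erm_fails J h g (nbr u) u eps s)
    \prod_k rbm_marg J h g (s k) <= 2 * 2 ^+ rbm_D J h g / Q.
  have n0 : (0 < n)%N by case: u => i /(leq_ltn_trans (leq0n _)).
  have Q0 : 0 < Q by rewrite divr_gt0// !mulr_gt0 ?ltr0n ?exprn_gt0.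
  have [g0|g0] := leP gamma 0.
    rewrite big_pred0; first by rewrite divr_ge0 ?(ltW Q0)// mulr_ge0// exprn_ge0.
    move=> s; apply/negbTE/erm_fails_gamma0 => //.
    by apply/eqP; rewrite eq_le g0.
  apply: le_trans (erm_fails_prob M (unbr u) eps0 (trunc u) g0) _.
  apply: ler_pM; rewrite ?mulr_ge0 ?expR_ge0//.
    by rewrite ler_pM2l// -natrX ler_nat (card_subsets_le_D (nbrs u)).
  (* The sample size condition [HM] says that the exponent is at least [ln Q]. *)
  rewrite expRN lef_pV2 ?posrE ?expR_gt0// -[leLHS]lnK ?posrE// ler_expR.
  move: HM; rewrite -/gamma ler_pdivrMr ?exprn_gt0// ler_pdivlMr.
    by rewrite [leLHS]mulrC.
  by rewrite mulr_gt0// exprn_gt0.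
set E := fun s => forall u w, _ -> _.
pose W (s : {ffun 'I_M -> cube n}) := \prod_k rbm_marg J h g (s k).
have W0 s : 0 <= W s by apply: prodr_ge0 => k _; apply: rbm_marg_ge0.
rewrite lerBlDr /sample_prob -[leLHS](sum_prod_rbm_marg J h g M).
rewrite [leLHS](bigID (fun s => `[< E s >]))/= lerD2l.
(* Union bound: a sample outside [E] fails at some [u]. *)
apply: (@le_trans _ _ (\sum_u \sum_(s | erm_fails J h g (nbr u) u eps s) W s)).
  under [leRHS]eq_bigr do rewrite big_mkcond/=.
  rewrite exchange_big big_mkcond/=; apply: ler_sum => s _.
  have [_|/asboolP notE] := boolP (`[< E s >]).
    by apply: sumr_ge0 => u _; case: ifP.
  have [u [w /not_implyP[ew /negP]]] : exists u w, ~ (is_erm (nbr u) u (2 * gamma) s w ->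
      pred_err J h g (nbr u) u w <= eps).
    by move/existsNP: notE => [u /existsNP[w ?]]; exists u, w.
  rewrite -ltNge => err; rewrite (bigD1 u)//=.
  rewrite ifT ?lerDl; last by apply/asboolP; exists w.
  by apply: sumr_ge0 => v _; case: ifP.
apply: le_trans (ler_sum _ (fun u _ => fail u)) _.
rewrite sumr_const card_ord -[leLHS]mulr_natl.
(* With no observed variable the union bound is 0; otherwise it totals [delta / 4]. *)
have [n0|n0] := posnP n.
  have -> : n%:R = 0 :> R by rewrite n0.
  by rewrite mul0r ltW.
have n0' : 0 < n%:R :> R by rewrite ltr0n.
have D0 : 0 < 2 ^+ rbm_D J h g :> R by rewrite exprn_gt0.
have cancel (a b d : R) : 0 < a -> 0 < b -> 0 < d ->
    a * (2 * b / (8 * a * b / d)) = d / 4.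
  by move=> a0 b0 d0; field; rewrite ?lt0r_neq0.
by rewrite /Q cancel// ler_pdivrMr// ler_pMr// ler1n.
Qed.
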